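(* Let $(f_1,\ldots,f_N;p_1,\ldots,p_N)$ be an admissible iterated function system and let $P$ be the corresponding Markov operator. Let $\mu_*\in\mathcal M_1((0,1))$ be its unique invariant measure in $\mathcal M_1((0,1))$. Then for every $\mu\in\mathcal M_1((0,1))$ and every continuous function $\varphi:[0,1]\to\mathbb R$, $$\lim_{n\to\infty}\int_{[0,1]}\varphi\,\mathrm d(P^n\mu)=\int_{[0,1]}\varphi\,\mathrm d\mu_*.$$
   Context: $H^+$ denotes the set of increasing homeomorphisms $f:[0,1]\to[0,1]$ that are $C^1$ in a neighbourhood (in $[0,1]$) of $0$ and of $1$. Let $f_1,\ldots,f_N\in H^+$ be finitely many homeomorphisms and let $(p_1,\ldots,p_N)$ satisfy $p_i>0$ for all $i$ and $\sum_{i=1}^N p_i=1$. The family $(f_1,\ldots,f_N;p_1,\ldots,p_N)$ is called an admissible iterated function system if: (1) for every $x\in(0,1)$ there are $i,j\in\{1,\ldots,N\}$ with $f_i(x)<x<f_j(x)$; (2) $f_i'(0)>0$ and $f_i'(1)>0$ for all $i$, and $\sum_{i=1}^N p_i\log f_i'(0)>0$ and $\sum_{i=1}^N p_i\log f_i'(1)>0$. The corresponding Markov operator $P$ acts on finite Borel measures on $[0,1]$ by $P\mu(A)=\sum_{i=1}^N p_i\,\mu(f_i^{-1}(A))$ for Borel $A\subseteq[0,1]$. A measure $\mu$ is invariant if $P\mu=\mu$. $\mathcal M_1((0,1))$ is the set of Borel probability measures on $(0,1)$, identified with the Borel probability measures $\mu$ on $[0,1]$ satisfying $\mu(\{0,1\})=0$.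 For an admissible iterated function system, $P$ has exactly one invariant measure in $\mathcal M_1((0,1))$; it is denoted $\mu_*$. *)

(* Defs.v *)
From HB Require Import structures.
From mathcomp Require Import all_boot all_order all_algebra.
From mathcomp Require Import all_classical all_reals all_analysis measurable_realfun.

Set Implicit Arguments.
Unset Strict Implicit.
Unset Printing Implicit Defensive.
Import Order.TTheory GRing.Theory Num.Theory.
Import numFieldNormedType.Exports.

Local Open Scope classical_set_scope.
Local Open Scope ring_scope.

(* Functions on [0,1] are represented by functions
   R -> R of which only the restriction to [0,1] is ever used, and Borel
   measures on [0,1] by Borel measures on R carried by [0,1]. *)

Definition I01 (R : realType) : set R := `[0, 1]%classic.
Arguments I01 {R}.

(* The derivative relative to [0,1], hence one-sided at 0 and at 1. *)
Definition derivable01 (R : realType) (f : R -> R) (x : R) : Prop :=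
  cvg ((f y - f x) / (y - x) @[y --> within I01 x^']).

Definition deriv01 (R : realType) (f : R -> R) (x : R) : R :=
  lim ((f y - f x) / (y - x) @[y --> within I01 x^']).

Definition C1_near (R : realType) (f : R -> R) (a : R) : Prop :=
  exists U : set R, [/\ nbhs a U,
    forall x, (U `&` I01) x -> derivable01 f x &
    {within U `&` I01, continuous (deriv01 f)}].

Definition homeomorphism01 (R : realType) (f : R -> R) : Prop :=
  [/\ set_bij I01 I01 f,
      {within I01, continuous f} &
      exists g : R -> R,
        (forall x, I01 x -> g (f x) = x) /\ {within I01, continuous g}].

Record Hplus (R : realType) := MkHplus {
  Hplus_fun :> R -> R;
  Hplus_homeo : homeomorphism01 Hplus_fun;
  Hplus_incr : {in I01 &, {homo Hplus_fun : x y / x < y}};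
  Hplus_C1_0 : C1_near Hplus_fun 0;
  Hplus_C1_1 : C1_near Hplus_fun 1 }.

(* Positivity of the weights is part of the type {posnum R}. *)
Record admissible (R : realType) (N : nat)
    (f : 'I_N -> Hplus R) (p : 'I_N -> {posnum R}) : Prop := MkAdmissible {
  admissible_sum : \sum_(i < N) (p i)%:num = 1;
  admissible_move : forall x : R, 0 < x < 1 ->
    exists i j : 'I_N, f i x < x < f j x;
  admissible_deriv0 : forall i, 0 < deriv01 (f i) 0;
  admissible_deriv1 : forall i, 0 < deriv01 (f i) 1;
  admissible_exp0 : 0 < \sum_(i < N) (p i)%:num * ln (deriv01 (f i) 0);
  admissible_exp1 : 0 < \sum_(i < N) (p i)%:num * ln (deriv01 (f i) 1) }.

Section markov.
Context (R : realType) (N : nat).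
Variables (f : 'I_N -> Hplus R) (p : 'I_N -> {posnum R}).
Local Open Scope ereal_scope.

(* [I01 `&` f i @^-1` A] is the preimage of A under f i : [0,1] -> [0,1]. *)
Definition markov_fun (mu : {finite_measure set (measurableTypeR R) -> \bar R})
    (A : set (measurableTypeR R)) : \bar R :=
  \sum_(i < N) (p i)%:num%:E * mu (I01 `&` f i @^-1` A).

Variable mu : {finite_measure set (measurableTypeR R) -> \bar R}.

Let measurable_pre i (A : set (measurableTypeR R)) :
  measurable A -> measurable (I01 `&` f i @^-1` A : set (measurableTypeR R)).
Proof.
move=> mA; have [_ cf _] := Hplus_homeo (f i).
have mI : measurable (I01 : set (measurableTypeR R)) by exact: measurable_itv.
exact: (subspace_continuous_measurable_fun mI cf).
Qed.

Let markov_fun0 : markov_fun mu set0 = 0.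
Proof.
by rewrite /markov_fun big1// => i _; rewrite preimage_set0 setI0 measure0 mule0.
Qed.

Let markov_fun_ge0 A : 0 <= markov_fun mu A.
Proof. by apply: sume_ge0 => i _; rewrite mule_ge0// lee_fin. Qed.

Let markov_fun_sigma_additive : semi_sigma_additive (markov_fun mu).
Proof.
move=> F mF tF mUF.
rewrite [X in X @ \oo --> _](_ : _ = fun n => \sum_(i < N)
    (p i)%:num%:E * \sum_(0 <= k < n) mu (I01 `&` f i @^-1` F k)); last first.
  apply/funext => n; rewrite /markov_fun exchange_big/=.
  by apply: eq_bigr => i _; rewrite ge0_sume_distrr.
apply: cvg_nnesum => [i _|i _].
  by apply: nearW => n; rewrite mule_ge0 ?lee_fin// sume_ge0.
apply: cvgeZl => //.
rewrite preimage_bigcup setI_bigcupr.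
apply: (measure_semi_sigma_additive (s := mu)) => [k||].
- exact: measurable_pre.
- move=> k l _ _ [x [[_ Fkx] [_ Flx]]].
  by apply: tF => //; exists (f i x).
- by apply: bigcup_measurable => k _; exact: measurable_pre.
Qed.

HB.instance Definition _ := isMeasure.Build _ _ _ (markov_fun mu)
  markov_fun0 markov_fun_ge0 markov_fun_sigma_additive.

Let markov_fun_fin : fin_num_fun (markov_fun mu).
Proof.
move=> A mA; apply/sum_fin_numP => i _ _.
by rewrite fin_numM// fin_num_measure//; exact: measurable_pre.
Qed.

HB.instance Definition _ := Measure_isFinite.Build _ _ _ (markov_fun mu)
  markov_fun_fin.

End markov.

Definition markov_op (R : realType) (N : nat)
    (f : 'I_N -> Hplus R) (p : 'I_N -> {posnum R})
    (mu : {finite_measure set (measurableTypeR R) -> \bar R}) :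
  {finite_measure set (measurableTypeR R) -> \bar R} := markov_fun f p mu.

Definition invariant_measure (R : realType) (N : nat)
    (f : 'I_N -> Hplus R) (p : 'I_N -> {posnum R})
    (mu : {finite_measure set (measurableTypeR R) -> \bar R}) : Prop :=
  forall A : set (measurableTypeR R), measurable A -> markov_op f p mu A = mu A.

(* Borel probability measures on (0,1), as probability measures on [0,1] that
   do not charge the endpoints. *)
Definition M1_01 (R : realType) (mu : probability (measurableTypeR R) R) : Prop :=
  mu (~` I01) = 0%E /\ mu [set 0; 1] = 0%E.

(* Main.v *)
Require Import Defs.
From HB Require Import structures.
From mathcomp Require Import all_boot all_order all_algebra.
From mathcomp Require Import all_classical all_reals all_analysis measurable_realfun.
From mathcomp Require Import ring lra.
Import Order.TTheory GRing.Theory Num.Theory.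
Import numFieldNormedType.Exports.
Local Open Scope classical_set_scope.
Local Open Scope ring_scope.

Set Implicit Arguments.
Unset Strict Implicit.

(** Let U h = \sum_i p_i (h o f_i) be the dual of the Markov operator and let
    g_n = U^n id, an increasing function with values in [0,1].  By invariance,
    the integrals of g_n ^ 2 against mu_star decrease, with decrement the integral
    of U (g_n ^ 2) - (U g_n) ^ 2, which dominates a multiple of
    (g_n o f_j - g_n o f_i) ^ 2.  Hence g_n (f_j x) - g_n (f_i x) tends to 0 in mean
    square, and by monotonicity the oscillation of g_n on every [u, v] with
    f_i z < u <= v < f_j z tends to 0 when z is in the support of mu_star.  Such
    intervals cover (0,1), because the support is forward invariant and every
    point of (0,1) is moved both to the left and to the right, so g_n y - g_n x
    tends to 0 for x, y in (0,1).  A modulus of continuity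
    |phi x - phi y| <= e + C (y - x) is transported by U^n to
    |U^n phi x - U^n phi y| <= e + C (g_n y - g_n x); so U^n phi becomes asymptotically
    constant on (0,1), and dominated convergence concludes. *)

(** * Continuous functions on $[0,1]$ and composition with elements of $H^+$ *)

Section transfer_operator.
Context {R : realType}.
Implicit Types (h k : R -> R) (x y e d : R).

Local Notation cont01 h := {within I01, continuous h}.

Lemma I01E x : I01 x = (0 <= x <= 1) :> Prop.
Proof. by rewrite /I01 /= in_itv. Qed.

Lemma ball_subset_I01 (z : R) : 0 < z < 1 -> exists2 d : R, 0 < d & ball z d `<=` I01.
Proof.
move=> /andP[z0 z1]; exists (Num.min z (1 - z)).
  by rewrite lt_min z0 subr_gt0.
move=> x; rewrite /ball/= lt_min => /andP[].
by rewrite !ltr_norml I01E => /andP[? ?] /andP[? ?]; apply/andP; split; lra.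
Qed.

Lemma compact_I01 : compact (I01 : set R).
Proof. exact: segment_compact. Qed.

Lemma measurable_I01 : measurable (I01 : set (measurableTypeR R)).
Proof. exact: measurable_itv. Qed.

Lemma cont01_measurable h : cont01 h ->
  measurable_fun (I01 : set (measurableTypeR R)) (h : _ -> measurableTypeR R).
Proof.
by move=> ch; exact: (subspace_continuous_measurable_fun measurable_I01 ch).
Qed.

Lemma cont01_bounded h : cont01 h ->
  exists2 M, 0 <= M & forall x, I01 x -> `|h x| <= M.
Proof.
move=> ch.
have /compact_bounded[M [_ hM]] := continuous_compact ch compact_I01.
exists (`|M| + 1); first by rewrite addr_ge0.
move=> x Ix; apply: (hM (`|M| + 1)); last by exists x.
by rewrite ltr_pwDr// ler_norm.
Qed.

Lemma cont01_integrable (mu : {finite_measure set (measurableTypeR R) -> \bar R})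
  h : cont01 h -> mu.-integrable I01 (EFin \o h).
Proof.
move=> ch; apply: measurable_bounded_integrable.
- exact: measurable_I01.
- by rewrite -ge0_fin_numE// fin_num_measure//; exact: measurable_I01.
- exact: cont01_measurable.
- have [M _ hM] := cont01_bounded ch.
  exists M; split; rewrite ?num_real// => M' MM' x Ix.
  by apply: le_trans (ltW MM'); exact: hM.
Qed.

Lemma Hplus_I01 (f : Hplus R) x : I01 x -> I01 (f x).
Proof. by case: (Hplus_homeo f) => -[] /(_ x). Qed.

Lemma Hplus_cont (f : Hplus R) : cont01 f.
Proof. by case: (Hplus_homeo f). Qed.

Lemma Hplus_lt (f : Hplus R) x y : I01 x -> I01 y -> x < y -> f x < f y.
Proof. by move=> Ix Iy; apply: Hplus_incr; rewrite inE. Qed.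

Lemma Hplus_le (f : Hplus R) x y : I01 x -> I01 y -> x <= y -> f x <= f y.
Proof.
move=> Ix Iy; rewrite le_eqVlt => /predU1P[->//|xy].
by apply/ltW/Hplus_lt.
Qed.

Lemma Hplus_itvoo (f : Hplus R) x : 0 < x < 1 -> 0 < f x < 1.
Proof.
move=> /andP[x0 x1].
have Ix : I01 x by rewrite I01E !ltW.
have I0 : I01 (0 : R) by rewrite I01E lexx ler01.
have I1 : I01 (1 : R) by rewrite I01E lexx ler01.
have := Hplus_I01 f I0; rewrite I01E => /andP[f0 _].
have := Hplus_I01 f I1; rewrite I01E => /andP[_ f1].
by rewrite (le_lt_trans f0 (Hplus_lt f I0 Ix x0))
  (lt_le_trans (Hplus_lt f Ix I1 x1) f1).
Qed.

Lemma cont01P h : cont01 h <-> forall x e, I01 x -> 0 < e ->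
  exists2 d : R, 0 < d & forall y, I01 y -> `|x - y| < d -> `|h x - h y| < e.
Proof.
split=> [/subspace_continuousP ch x e Ix e0|ch].
  have /cvgrPdist_lt/(_ e e0) := ch x Ix.
  rewrite near_withinE => /nbhs_ballP[d d0 hd].
  by exists d => // y Iy xy; apply: hd.
apply/subspace_continuousP => x Ix; apply/cvgrPdist_lt => e e0.
rewrite near_withinE; have [d d0 hd] := ch x e Ix e0.
by apply/nbhs_ballP; exists d => // y xy Iy; exact: hd.
Qed.

Lemma cont01_comp (f : Hplus R) h : cont01 h -> cont01 (fun x => h (f x)).
Proof.
move=> /cont01P ch; apply/cont01P => x e Ix e0.
have [d d0 hd] := ch _ _ (Hplus_I01 f Ix) e0.
have /cont01P/(_ x d Ix d0)[d' d'0 hd'] := @Hplus_cont f.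
by exists d' => // y Iy xy; apply: hd (hd' y Iy xy); exact: Hplus_I01.
Qed.

Lemma cont01_cst (c : R) : cont01 (fun _ : R => c).
Proof. by move=> x; exact: cvg_cst. Qed.

Lemma cont01_id : cont01 (fun x : R => x).
Proof. by apply/cont01P => x e _ e0; exists e. Qed.

Lemma cont01D h k : cont01 h -> cont01 k -> cont01 (fun x => h x + k x).
Proof. by move=> ch ck x; apply: cvgD; [exact: ch|exact: ck]. Qed.

Lemma cont01B h k : cont01 h -> cont01 k -> cont01 (fun x => h x - k x).
Proof. by move=> ch ck x; apply: cvgB; [exact: ch|exact: ck]. Qed.

Lemma cont01M h k : cont01 h -> cont01 k -> cont01 (fun x => h x * k x).
Proof. by move=> ch ck x; apply: cvgM; [exact: ch|exact: ck]. Qed.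

Lemma cont01_sum (I : Type) (s : seq I) (h : I -> R -> R) :
  (forall i, cont01 (h i)) -> cont01 (fun x => \sum_(i <- s) h i x).
Proof.
move=> ch; elim: s => [|i s ih].
  by under eq_fun do rewrite big_nil; exact: cont01_cst.
by under eq_fun do rewrite big_cons; exact: cont01D.
Qed.

(** Uniform continuity handles pairs closer than some [d]; farther pairs use the crude bound
    [2 * M], which is at most [2 * M / d * (y - x)]. Unlike a general modulus of continuity, this
    affine one is stable under averaging. *)
Lemma cont01_lipschitz_up_to h e : cont01 h -> 0 < e ->
  exists2 C, 0 <= C & forall x y, I01 x -> I01 y -> x <= y ->
    `|h x - h y| <= e + C * (y - x).
Proof.
move=> ch e0; have [M M0 hM] := cont01_bounded ch.
have e20 : 0 < e / 2 by rewrite divr_gt0.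
have [d d0 hd] : exists2 d : R, 0 < d & forall x y, I01 x -> I01 y ->
    `|x - y| < d -> `|h x - h y| < e.
  (* Compactness in near-covering form: a radius that works near each point, for all small [t],
     gives one radius for the whole interval. *)
  have /compact_near_coveringP/near_covering_withinP := compact_I01.
  move=> /(_ R (0 : R)^'+
    (fun d x => forall y, I01 y -> `|x - y| < d -> `|h x - h y| < e)).
  have step x : I01 x -> \forall x' \near x & t \near (0 : R)^'+,
     I01 x' -> forall y, I01 y -> `|x' - y| < t -> `|h x' - h y| < e.
    move=> Ix; have /cont01P/(_ x _ Ix e20)[d d0 hd] := ch.
    exists (ball x (d / 2), [set t | 0 < t < d / 2]).
      split; first by apply: nbhsx_ballx; rewrite divr_gt0.
      near=> t; apply/andP; split; near: t.
        exact: nbhs_right_gt.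
      by apply: nbhs_right_lt; rewrite divr_gt0.
    move=> [x' t] [/= xx' /andP[t0 td]] Ix' y Iy x'y.
    (* Both [x'] and [y] lie within [d] of the centre [x], so each difference is below [e / 2]. *)
    have -> : h x' - h y = (h x - h y) - (h x - h x') by ring.
    rewrite (le_lt_trans (ler_normB _ _))// [ltRHS]splitr ltrD// hd//.
      have -> : x - y = (x - x') + (x' - y) by ring.
      rewrite (le_lt_trans (ler_normD _ _))// [ltRHS]splitr ltrD//.
      exact: lt_trans td.
    by rewrite (lt_trans xx')// ltr_pdivrMr// mulr_natr mulr2n ltrDl.
  move=> /(_ _ step) hnear.
  have [d [d0 hd]] : exists d : R, 0 < d /\ forall x, I01 x ->
      forall y, I01 y -> `|x - y| < d -> `|h x - h y| < e.
    near (0 : R)^'+ => d; exists d; split => //.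
    by near: d; exact: hnear.
  by exists d => // x y Ix Iy; apply: hd.
exists (2 * M / d); first by rewrite divr_ge0 ?mulr_ge0// ltW.
move=> x y Ix Iy xy.
have [xyd|dxy] := ltP (y - x) d.
  rewrite (le_trans (ltW (hd _ _ Ix Iy _)))//.
    by rewrite distrC ger0_norm// subr_ge0.
  by rewrite lerDl mulr_ge0 ?subr_ge0// divr_ge0 ?mulr_ge0// ltW.
rewrite (le_trans (ler_normB _ _))// (@le_trans _ _ (2 * M))//.
  by rewrite mulr_natl mulr2n lerD// hM.
rewrite (@le_trans _ _ (2 * M / d * (y - x)))//; last by rewrite lerDr ltW.
by rewrite mulrAC ler_pdivlMr// ler_wpM2l// mulr_ge0.
Unshelve. all: by end_near. Qed.

End transfer_operator.

(** * The dual of the Markov operator on continuous functions *)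

Section dual_operator.
Context {R : realType} {N : nat}.
Variables (f : 'I_N -> Hplus R) (p : 'I_N -> {posnum R}).
Implicit Types (h k : R -> R) (x y : R).

Local Notation cont01 h := {within I01, continuous h}.

Definition dual_op h : R -> R := fun x => \sum_(i < N) (p i)%:num * h (f i x).

Lemma cont01_dual_op h : cont01 h -> cont01 (dual_op h).
Proof.
move=> ch; apply: cont01_sum => i.
by apply: cont01M; [exact: cont01_cst|exact: cont01_comp].
Qed.

Lemma cont01_iter_dual_op h n : cont01 h -> cont01 (iter n dual_op h).
Proof. by move=> ch; elim: n => //= n; exact: cont01_dual_op. Qed.

Section duality.
Variable mu : {finite_measure set (measurableTypeR R) -> \bar R}.

(** On subsets of $[0,1]$ the image measure is a finite sum of scaled pushforwards of [mu], and the
    integral of a non-negative function splits accordingly. *)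
Lemma ge0_integral_markov_op h : cont01 h -> (forall x, I01 x -> 0 <= h x) ->
  (\int[markov_op f p mu]_(x in I01) (h x)%:E =
   \sum_(i < N) (p i)%:num%:E * \int[mu]_(x in I01) (h (f i x))%:E)%E.
Proof.
move=> ch h0.
(* The value 2 off [0,1] keeps preimages of subsets of [0,1] inside [0,1]. *)
pose fb i (x : measurableTypeR R) : measurableTypeR R :=
  if x \in I01 then f i x else 2.
have mfb i : measurable_fun setT (fb i).
  apply: measurable_fun_if => //.
  - apply: (measurable_fun_bool true); rewrite setTI.
    rewrite (_ : _ @^-1` _ = I01); first exact: measurable_I01.
    by apply/seteqP; split => x; [exact: set_mem|exact: mem_set].
  - rewrite setTI (_ : _ @^-1` _ = I01).
      exact: (cont01_measurable (@Hplus_cont _ (f i))).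
    by apply/seteqP; split => x; [exact: set_mem|exact: mem_set].
pose nu i : {measure set (measurableTypeR R) -> \bar R} :=
  measure_function_pushforward__canonical__measure_function_Measure mu (mfb i).
have p_ge0 i : (0 <= (p i)%:num)%R by [].
(* [msum] takes a sequence indexed by naturals, so the family is padded with the zero measure from
   [N] on. *)
pose m_ n : {measure set (measurableTypeR R) -> \bar R} :=
  if insub n : option 'I_N is Some i then
    mscale (NngNum (p_ge0 i)) (nu i) else mzero.
have mh : measurable_fun (I01 : set (measurableTypeR R)) (EFin \o h).
  by apply/measurable_EFinP; exact: cont01_measurable.
rewrite (eq_measure_integral (msum m_ N)); last first.
  move=> A mA AI; rewrite /msum/= /markov_op/= /markov_fun.
  apply: eq_bigr => i _; rewrite /m_ valK/= /mscale/=; congr (_ * mu _)%E.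
  apply/seteqP; split => x /=.
    by move=> [Ix Afx]; rewrite /fb mem_set.
  rewrite /fb; case: ifPn => [|_ /AI]; first by rewrite inE.
  by rewrite I01E => /andP[_]; rewrite leNgt ltr1n.
rewrite ge0_integral_measure_sum//; last exact: measurable_I01.
apply: eq_bigr => i _; rewrite /m_ valK.
rewrite ge0_integral_mscale//; last exact: measurable_I01.
congr (_ * _)%E; rewrite (ge0_integral_pushforward (mfb i))//.
- have -> : fb i @^-1` I01 = I01.
    apply/seteqP; split => x /=; rewrite /fb; last first.
      by move=> Ix; rewrite mem_set//; exact: Hplus_I01.
    case: ifPn => [|_]; first by rewrite inE.
    by rewrite I01E => /andP[_]; rewrite leNgt ltr1n.
  by apply: eq_integral => x Ix /=; rewrite /fb Ix.
- exact: measurable_I01.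
- by move=> x; rewrite inE lee_fin; exact: h0.
Qed.

Lemma Rintegral_cont01_sum (I : Type) (s : seq I) (h : I -> R -> R) :
  (forall i, cont01 (h i)) ->
  \int[mu]_(x in I01) (\sum_(i <- s) h i x) =
  \sum_(i <- s) \int[mu]_(x in I01) h i x.
Proof.
move=> ch; elim: s => [|i s ih].
  rewrite big_nil; under eq_Rintegral do rewrite big_nil.
  by rewrite Rintegral_cst ?mul0r//; exact: measurable_I01.
rewrite big_cons -ih -RintegralD//.
- by under eq_Rintegral do rewrite big_cons.
- exact: measurable_I01.
- exact: cont01_integrable.
- by apply: cont01_integrable; exact: cont01_sum.
Qed.

Lemma Rintegral_dual_op h : cont01 h ->
  \int[mu]_(x in I01) dual_op h x =
  \sum_(i < N) (p i)%:num * \int[mu]_(x in I01) h (f i x).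
Proof.
move=> ch; rewrite Rintegral_cont01_sum => [|i]; last first.
  by apply: cont01M; [exact: cont01_cst|exact: cont01_comp].
apply: eq_bigr => i _; rewrite RintegralZl//; first exact: measurable_I01.
by apply: cont01_integrable; exact: cont01_comp.
Qed.

(** The non-negative case applies to [h + M] and to the constant [M], where [M] bounds [h] in
    absolute value; cancelling the constant gives the general case. *)
Lemma Rintegral_markov_op h : cont01 h ->
  \int[markov_op f p mu]_(x in I01) h x = \int[mu]_(x in I01) dual_op h x.
Proof.
have ge0_case k : cont01 k -> (forall x, I01 x -> 0 <= k x) ->
    \int[markov_op f p mu]_(x in I01) k x = \int[mu]_(x in I01) dual_op k x.
  move=> ck k0; rewrite Rintegral_dual_op//.
  rewrite /Rintegral ge0_integral_markov_op// -EFin_sum_fine; last first.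
    move=> i _; apply: fin_numM => //; apply: integrable_fin_num.
      exact: measurable_I01.
    by apply: cont01_integrable; exact: cont01_comp.
  apply: eq_bigr => i _; rewrite fineM//; apply: integrable_fin_num.
    exact: measurable_I01.
  by apply: cont01_integrable; exact: cont01_comp.
move=> ch; have [M M0 hM] := cont01_bounded ch.
have mI := @measurable_I01 R.
have cM : cont01 (fun _ : R => M) by exact: cont01_cst.
have chM : cont01 (fun x => h x + M) by exact: cont01D.
have hM0 x : I01 x -> 0 <= h x + M.
  by move=> Ix; rewrite -lerBlDr sub0r (le_trans _ (lerNnormlW (hM x Ix))).
have := ge0_case _ chM hM0.
rewrite RintegralD//; [|exact: cont01_integrable|exact: cont01_integrable].
rewrite (ge0_case _ cM)//.
have dualD x : dual_op (fun x => h x + M) x = dual_op h x + dual_op (fun=> M) x.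
  by rewrite /dual_op -big_split/=; apply: eq_bigr => i _; rewrite mulrDr.
under [X in _ = X]eq_Rintegral do rewrite dualD.
rewrite [X in _ = X]RintegralD//; first exact: addIr.
- by apply: cont01_integrable; exact: cont01_dual_op.
- by apply: cont01_integrable; exact: cont01_dual_op.
Qed.

End duality.

Lemma Rintegral_iter_markov_op
    (mu : {finite_measure set (measurableTypeR R) -> \bar R}) h n : cont01 h ->
  \int[iter n (markov_op f p) mu]_(x in I01) h x =
  \int[mu]_(x in I01) iter n dual_op h x.
Proof.
elim: n h => // n ih h ch; rewrite iterS Rintegral_markov_op// ih.
  by rewrite -iterSr.
exact: cont01_dual_op.
Qed.

End dual_operator.

(** * Two inequalities: a lower bound on a variance, and Markov's inequality *)

(** The right side is the variance about the mean [c]; its terms [i] and [j] alone already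
    suffice. *)
Lemma weighted_variance_lower_bound (R : realType) (N : nat)
    (q a : 'I_N -> R) (i j : 'I_N) :
  (forall k, 0 <= q k) -> \sum_k q k = 1 ->
  q i * q j * (a j - a i) ^+ 2 <= \sum_k q k * a k ^+ 2 - (\sum_k q k * a k) ^+ 2.
Proof.
move=> q0 q1; set c := \sum_k q k * a k.
have -> : \sum_k q k * a k ^+ 2 - c ^+ 2 = \sum_k q k * (a k - c) ^+ 2.
  transitivity (\sum_k (q k * a k ^+ 2 - 2 * c * (q k * a k) + c ^+ 2 * q k)).
    by rewrite big_split sumrB/= -!mulr_sumr -/c q1; ring.
  by apply: eq_bigr => k _; ring.
have ge0 k : 0 <= q k * (a k - c) ^+ 2 by rewrite mulr_ge0// sqr_ge0.
have [->|ij] := eqVneq i j.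
  by rewrite subrr expr0n mulr0 sumr_ge0.
have qij : q i + q j <= 1.
  by rewrite -q1 (bigD1 i)//= lerD2l (bigD1 j) 1?eq_sym//= lerDl sumr_ge0.
rewrite (bigD1 i)//= (bigD1 j) 1?eq_sym//= addrA.
apply: (@le_trans _ _ (q i * (a i - c) ^+ 2 + q j * (a j - c) ^+ 2)); last first.
  by rewrite lerDl sumr_ge0.
rewrite -subr_ge0.
(* An exact identity whose right side is visibly non-negative because [q i + q j <= 1]. *)
have -> : q i * (a i - c) ^+ 2 + q j * (a j - c) ^+ 2
    - q i * q j * (a j - a i) ^+ 2 =
    (1 - (q i + q j)) * (q i * (a i - c) ^+ 2 + q j * (a j - c) ^+ 2) +
    (q i * (a i - c) + q j * (a j - c)) ^+ 2 by ring.
by rewrite addr_ge0 ?sqr_ge0// mulr_ge0 ?subr_ge0// addr_ge0.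
Qed.

(** Markov's inequality, for any measurable set on which [c] is a lower bound rather than for a full
    superlevel set. *)
Lemma markov_cont01 (R : realType)
    (mu : {finite_measure set (measurableTypeR R) -> \bar R}) (h : R -> R)
    (B : set (measurableTypeR R)) (c : R) :
  {within I01, continuous h} -> (forall x, I01 x -> 0 <= h x) ->
  measurable B -> B `<=` I01 -> 0 <= c -> (forall x, B x -> c <= h x) ->
  c * fine (mu B) <= \int[mu]_(x in I01) h x.
Proof.
move=> ch h0 mB BI c0 hB.
have mI := @measurable_I01 R.
have mh : measurable_fun (I01 : set (measurableTypeR R)) (EFin \o h).
  by apply/measurable_EFinP; exact: cont01_measurable.
rewrite -lee_fin EFinM fineK ?fin_num_measure// /Rintegral fineK; last first.
  by apply: integrable_fin_num => //; exact: cont01_integrable.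
rewrite -integral_cst//.
apply: (@le_trans _ _ (\int[mu]_(x in B) (h x)%:E)%E).
  by apply: ge0_le_integral => //=; exact: measurable_funS mh.
exact: ge0_subset_integral.
Qed.

(** * Decrease of the second moment of $U^n \mathrm{id}$ and its consequences *)

Section contraction.
Context {R : realType} {N : nat}.
Variables (f : 'I_N -> Hplus R) (p : 'I_N -> {posnum R}).
Hypothesis sum_p : \sum_(i < N) (p i)%:num = 1.
Implicit Types (h k : R -> R) (x y u v z : R) (n : nat).

Local Notation cont01 h := {within I01, continuous h}.
Local Notation U := (dual_op f p).
Local Notation g n := (iter n U idfun).

(** The hypothesis is averaged over the ordered pairs [f i x <= f i y]; the weights sum to 1, so [e]
    is unchanged. *)
Lemma dual_op_lipschitz_up_to h k e C :
  (forall x y, I01 x -> I01 y -> x <= y -> `|h x - h y| <= e + C * (k y - k x)) ->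
  forall x y, I01 x -> I01 y -> x <= y ->
    `|U h x - U h y| <= e + C * (U k y - U k x).
Proof.
move=> hk x y Ix Iy xy.
rewrite -(mul1r e) -sum_p mulr_suml -!sumrB mulr_sumr -big_split/=.
rewrite (le_trans (ler_norm_sum _ _ _))//; apply: ler_sum => i _.
rewrite -!mulrBr normrM gtr0_norm// mulrCA -mulrDr ler_wpM2l// hk//;
  by [exact: Hplus_I01|exact: Hplus_le].
Qed.

Lemma iter_dual_op_lipschitz_up_to h e C n :
  (forall x y, I01 x -> I01 y -> x <= y -> `|h x - h y| <= e + C * (y - x)) ->
  forall x y, I01 x -> I01 y -> x <= y ->
    `|iter n U h x - iter n U h y| <= e + C * (g n y - g n x).
Proof. by move=> hC; elim: n => //= n ih; exact: dual_op_lipschitz_up_to. Qed.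

Lemma iter_dual_op_id_le n x y : I01 x -> I01 y -> x <= y -> g n x <= g n y.
Proof.
elim: n x y => //= n ih x y Ix Iy xy; apply: ler_sum => i _.
by rewrite ler_wpM2l// ih//; [exact: Hplus_I01|exact: Hplus_I01|exact: Hplus_le].
Qed.

Lemma cont01_iter_dual_op_id n : cont01 (g n).
Proof. by apply: cont01_iter_dual_op; exact: cont01_id. Qed.

Variable mu : probability (measurableTypeR R) R.
Hypothesis invmu : invariant_measure f p mu.

Lemma invariant_Rintegral_dual_op h : cont01 h ->
  \int[mu]_(x in I01) U h x = \int[mu]_(x in I01) h x.
Proof.
move=> ch; rewrite -Rintegral_markov_op//; congr fine.
by apply: eq_measure_integral => A mA _; exact: invmu.
Qed.

(** By invariance the mean of [g n] does not depend on [n], so [V n] is the variance of [g n] up to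
    a constant. *)
Let V n := \int[mu]_(x in I01) (g n x ^+ 2).

Let cont01_sqr h : cont01 h -> cont01 (fun x => h x ^+ 2).
Proof. by move=> ch; apply: cont01M. Qed.

(** Invariance removes the outer [U] from the first term, and the second is the square of
    [g n.+1]. *)
Lemma variance_decrementE n :
  \int[mu]_(x in I01) (U (fun x => g n x ^+ 2) x - U (g n) x ^+ 2) = V n - V n.+1.
Proof.
have cg := @cont01_iter_dual_op_id n.
rewrite RintegralB ?invariant_Rintegral_dual_op//.
- exact: cont01_sqr.
- exact: measurable_I01.
- by apply: cont01_integrable; apply: cont01_dual_op; exact: cont01_sqr.
- by apply: cont01_integrable; apply: cont01_sqr; exact: cont01_dual_op.
Qed.

Lemma jensen_gap h i j x :
  (p i)%:num * (p j)%:num * (h (f j x) - h (f i x)) ^+ 2 <=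
  U (fun x => h x ^+ 2) x - U h x ^+ 2.
Proof.
exact: (@weighted_variance_lower_bound _ _
  (fun l => (p l)%:num) (fun l => h (f l x))).
Qed.

(** [V] is non-increasing and bounded below by 0, hence convergent, so its successive differences
    vanish in the limit. *)
Lemma variance_decrement_cvg0 : V n - V n.+1 @[n --> \oo] --> 0.
Proof.
(* An index is needed: [jensen_gap] with twice the same index says that the decrement is
   non-negative. *)
have N0 : (0 < N)%N.
  case: N f p sum_p => // f' p'; rewrite big_ord0 => /esym/eqP.
  by rewrite oner_eq0.
have Vge0 n : 0 <= V n by apply: Rintegral_ge0 => x _; rewrite sqr_ge0.
have Vdecr : nonincreasing_seq V.
  apply/nonincreasing_seqP => n; rewrite -subr_ge0 -variance_decrementE.
  apply: Rintegral_ge0 => x Ix.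
  apply: le_trans (jensen_gap _ (Ordinal N0) (Ordinal N0) _).
  by rewrite subrr expr0n mulr0.
have cV : cvgn V.
  apply: nonincreasing_is_cvgn => //.
  by exists 0 => _ [n _ <-]; exact: Vge0.
rewrite -(subrr (limn V)); apply: cvgB => //.
by have := cV; rewrite -(cvg_shiftS V).
Qed.

(** Membership in the topological support of [mu]. *)
Definition charged z := forall e, 0 < e -> (0 < mu (ball z e))%E.

(** By continuity [f i x < u] and [v < f j x] for all [x] in a small ball around [z]. There
    monotonicity bounds [g n v - g n u] by [g n (f j x) - g n (f i x)], and the ball has positive
    mass, so Markov's inequality compares the square with [V n - V n.+1]. *)
Lemma charged_gap_cvg0 z i j u v : 0 < z < 1 -> charged z ->
  I01 u -> I01 v -> f i z < u -> u <= v -> v < f j z ->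
  g n v - g n u @[n --> \oo] --> 0.
Proof.
move=> z01 chz Iu Iv iu uv vj; have /andP[z0 z1] := z01.
have Iz : I01 z by rewrite I01E !ltW.
have [d [d0 hdI hdi hdj]] : exists d : R, [/\ 0 < d, ball z d `<=` I01,
    forall x, ball z d x -> f i x < u & forall x, ball z d x -> v < f j x].
  have /cont01P/(_ z (u - f i z) Iz) := @Hplus_cont _ (f i).
  rewrite subr_gt0 => /(_ iu)[d1 d10 hd1].
  have /cont01P/(_ z (f j z - v) Iz) := @Hplus_cont _ (f j).
  rewrite subr_gt0 => /(_ vj)[d2 d20 hd2].
  have [d3 d30 hd3] := ball_subset_I01 z01.
  have hI x : ball z (Num.min d1 (Num.min d2 d3)) x -> I01 x.
    by move=> xd; apply: hd3; move: xd; rewrite /ball/= !lt_min => /and3P[].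
  exists (Num.min d1 (Num.min d2 d3)); split => //.
  - by rewrite lt_min d10 lt_min d20.
  - move=> x xd; have := xd; rewrite /ball/= !lt_min => /and3P[xd1 _ _].
    have := hd1 _ (hI _ xd) xd1; rewrite ltr_norml => /andP[? ?]; lra.
  - move=> x xd; have := xd; rewrite /ball/= !lt_min => /and3P[_ xd2 _].
    have := hd2 _ (hI _ xd) xd2; rewrite ltr_norml => /andP[? ?]; lra.
have mB : measurable (ball z d : set (measurableTypeR R)) by exact: measurable_ball.
(* The constant of [jensen_gap] times the mass of the ball. *)
pose K := (p i)%:num * (p j)%:num * fine (mu (ball z d)).
have K0 : 0 < K.
  rewrite !mulr_gt0// fine_gt0// chz//= -ge0_fin_numE//.
  exact: fin_num_measure.
have guv n : 0 <= g n v - g n u by rewrite subr_ge0 iter_dual_op_id_le.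
have bound n : (g n v - g n u) ^+ 2 * K <= V n - V n.+1.
  rewrite -variance_decrementE /K mulrA mulrC [X in _ * X]mulrC mulrC.
  apply: markov_cont01 => //.
  - have cg := @cont01_iter_dual_op_id n.
    by apply: cont01B; [apply: cont01_dual_op; exact: cont01_sqr|
      apply: cont01_sqr; exact: cont01_dual_op].
  - move=> x Ix; apply: le_trans (jensen_gap _ i i x).
    by rewrite subrr expr0n mulr0.
  - by rewrite mulr_ge0// sqr_ge0.
  - move=> x xd; apply: le_trans (jensen_gap _ i j x).
    have Ix := hdI _ xd.
    rewrite ler_wpM2l// ler_sqr ?nnegrE//.
      apply: lerB; apply: iter_dual_op_id_le => //;
        by [exact: Hplus_I01|exact/ltW/hdi|exact/ltW/hdj].
    rewrite subr_ge0 iter_dual_op_id_le//; try exact: Hplus_I01.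
    exact/ltW/(lt_trans (hdi _ xd))/(le_lt_trans uv)/hdj.
apply/cvgrPdist_lt => e e0.
have eK : 0 < e ^+ 2 * K by rewrite mulr_gt0// exprn_gt0.
have /cvgrPdist_lt/(_ _ eK) := variance_decrement_cvg0.
apply: filterS => n; rewrite !sub0r !normrN => H.
rewrite ger0_norm// -(@ltr_pXn2r _ 2)// ?nnegrE ?(ltW e0)//.
rewrite -(ltr_pM2r K0) (le_lt_trans (bound n))//.
exact: le_lt_trans (ler_norm _) H.
Qed.

End contraction.

(** * The support of the invariant measure and flatness of $U^n \mathrm{id}$ on $(0,1)$ *)

Section support.
Context {R : realType} {N : nat}.
Variables (f : 'I_N -> Hplus R) (p : 'I_N -> {posnum R}).
Hypothesis sum_p : \sum_(i < N) (p i)%:num = 1.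
Hypothesis moves : forall x : R, 0 < x < 1 -> exists i j : 'I_N, f i x < x < f j x.
Variable mu : probability (measurableTypeR R) R.
Hypothesis invmu : invariant_measure f p mu.
Hypothesis mu01 : M1_01 mu.
Implicit Types (x y u v w z e : R) (n : nat).

Local Notation g n := (iter n (dual_op f p) idfun).

Lemma charged_closed z :
  (forall e, 0 < e -> exists2 y, `|z - y| < e & charged mu y) -> charged mu z.
Proof.
move=> H e e0; have e20 : 0 < e / 2 by rewrite divr_gt0.
have [y zy cy] := H _ e20.
rewrite (lt_le_trans (cy _ e20))// le_measure ?inE//; try exact: measurable_ball.
move=> x; rewrite /ball/= => yx.
have -> : z - x = (z - y) + (y - x) by ring.
by rewrite (le_lt_trans (ler_normD _ _))// [ltRHS]splitr ltrD.
Qed.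

(** By invariance a ball around [f i z] has at least [p i] times the mass of its preimage, which
    contains a ball around [z]. *)
Lemma charged_image z i : 0 < z < 1 -> charged mu z -> charged mu (f i z).
Proof.
move=> z01 cz e e0; have [z0 z1] := andP z01.
have Iz : I01 z by rewrite I01E !ltW.
have [d1 d10 dI] := ball_subset_I01 z01.
have /cont01P/(_ z e Iz e0)[d2 d20 hd] := @Hplus_cont _ (f i).
pose d := Num.min d1 d2.
have d0 : 0 < d by rewrite lt_min d10.
have bI x : ball z d x -> I01 x.
  by rewrite /ball/= lt_min => /andP[xd _]; exact: dI.
have mI := @measurable_I01 R.
have mb : measurable (ball (f i z) e : set (measurableTypeR R)).
  exact: measurable_ball.
have mpre : measurable (I01 `&` f i @^-1` ball (f i z) e : set (measurableTypeR R)).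
  exact: (cont01_measurable (@Hplus_cont _ (f i)) mI mb).
rewrite -(invmu mb) /markov_op/= /markov_fun (bigD1 i)//=.
apply: (@lt_le_trans _ _ ((p i)%:num%:E * mu (ball z d))%E).
  by rewrite mule_gt0// ?lte_fin// cz.
apply: (@le_trans _ _ ((p i)%:num%:E * mu (I01 `&` f i @^-1` ball (f i z) e))%E).
  rewrite lee_pmul2l//= le_measure ?inE//; first exact: measurable_ball.
  move=> x xd; split; first exact: bI.
  apply: hd; first exact: bI.
  by move: xd; rewrite /ball/= lt_min => /andP[].
rewrite leeDl// sume_ge0// => k _.
by rewrite mule_ge0// lee_fin.
Qed.

(** Every uncharged point lies in a null open interval with rational endpoints, and there are
    countably many of these. *)
Lemma uncharged_negligible : mu.-negligible [set z : measurableTypeR R | ~ charged mu z].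
Proof.
(* Enumerates the null rational intervals; every other code yields the empty set. *)
pose F n : set (measurableTypeR R) := if @unpickle (rat * rat)%type n is Some qr then
  if mu `]ratr qr.1, ratr qr.2[%classic == 0%E
  then `]ratr qr.1, ratr qr.2[%classic else set0 else set0.
apply: (@negligibleS _ _ _ mu (\bigcup_n F n)).
  move=> z /existsNP[e] /not_implyP[e0 /negP].
  rewrite lt_def measure_ge0 andbT negbK => /eqP ze.
  have [q /[!in_itv]/= /andP[zq qz]] := @rat_in_itvoo R (z - e) z ltac:(lra).
  have [r /[!in_itv]/= /andP[zr rz]] := @rat_in_itvoo R z (z + e) ltac:(lra).
  exists (pickle (q, r)); first exact: I.
  rewrite /F pickleK.
  suff -> : mu `]ratr q, ratr r[%classic = 0%E by rewrite eqxx /= in_itv /= qz zr.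
  apply/eqP; rewrite eq_le measure_ge0 andbT -ze le_measure ?inE//=.
    exact: measurable_ball.
  move=> x; rewrite /= in_itv/= /ball/= ltr_norml => /andP[? ?].
  by apply/andP; split; lra.
apply: negligible_bigcup => n; rewrite /F.
case: unpickle => [[q r]|]; last exact: negligible_set0.
case: ifPn => [/eqP mu0|_]; last exact: negligible_set0.
by apply/negligibleP.
Qed.

Lemma itvoo_not_negligible : ~ mu.-negligible (`]0, 1[%classic : set (measurableTypeR R)).
Proof.
move=> neg.
have : mu.-negligible (setT : set (measurableTypeR R)).
  apply: (@negligibleS _ _ _ mu
    ((`]0, 1[ `|` [set 0; 1]) `|` ~` I01 : set (measurableTypeR R))).
    move=> x _; have [|nIx] := pselect (I01 x); last by right.
    rewrite I01E !le_eqVlt => /andP[/predU1P[<-|x0] /predU1P[->|x1]];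
      left; by [right; left|right; right|left; rewrite /= in_itv/= x0 x1].
  have mI := @measurable_I01 R.
  apply: negligibleU; first apply: negligibleU => //.
    by apply/negligibleP; [exact: measurableU|exact: mu01.2].
  by apply/negligibleP; [exact: measurableC|exact: mu01.1].
move=> /(measure_negligible measurableT) muT0.
by have /eqP := probability_setT mu; rewrite muT0 eq_sym onee_eq0.
Qed.

(** Let [s] be the infimum of the charged points in $(0,1)$. If [w <= s], then [s] is positive and
    charged, and some [f i] moves it to a smaller charged point, a contradiction. So [s < w], and
    charged points near [s] lie below [w]. *)
Lemma charged_le w : 0 < w < 1 -> exists z, 0 < z <= w /\ charged mu z.
Proof.
move=> /andP[w0 w1].
pose S := [set z : R | 0 < z < 1 /\ charged mu z].
have S0 : S !=set0.
  apply/set0P/eqP => S0; apply: itvoo_not_negligible.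
  apply: negligibleS uncharged_negligible => z/=.
  rewrite in_itv/= => z01 cz.
  by have : S z by []; rewrite S0.
have lbS : has_lbound S by exists 0 => z [/andP[/ltW]].
have hiS : has_inf S by [].
pose s := inf S.
have s0 : 0 <= s by apply: lb_le_inf => // z [/andP[/ltW]].
have s1 : s < 1.
  by have [z Sz] := S0; rewrite (le_lt_trans (ge_inf lbS Sz))//; case: Sz => /andP[].
have [sw|ws] := ltP s w.
  have ws0 : 0 < w - s by rewrite subr_gt0.
  have [z Sz zw] := inf_adherent ws0 hiS.
  move: zw; rewrite -/s addrC subrK => zw.
  by exists z; case: Sz => /andP[z0 _] cz; split => //; rewrite z0 ltW.
exfalso.
have s01 : 0 < s < 1 by rewrite s1 andbT (lt_le_trans w0).
have cs : charged mu s.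
  apply: charged_closed => e e0.
  have [z Sz zs] := inf_adherent e0 hiS.
  exists z; last by case: Sz.
  have := ge_inf lbS Sz; rewrite -/s => sz.
  by rewrite distrC ger0_norm ?subr_ge0// ltrBlDl.
have [i [j /andP[fs _]]] := moves s01.
have : S (f i s) by split; [exact: Hplus_itvoo|exact: charged_image].
by move=> /(ge_inf lbS); rewrite -/s leNgt fs.
Qed.

(** The point [w] is enclosed between [f i a] and [f j a] for a charged point [a], where
    [charged_gap_cvg0] applies; [charged_le] makes such an [a] available. *)
Lemma locally_flat w : 0 < w < 1 -> exists u v,
  [/\ 0 < u < w, w < v < 1 & g n v - g n u @[n --> \oo] --> 0].
Proof.
move=> w01; have [w0 w1] := andP w01.
pose S := [set z : R | 0 < z <= w /\ charged mu z].
have [z0 Sz0] : S !=set0 by exact: charged_le.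
have ubS : has_ubound S by exists w => z [/andP[]].
have hsS : has_sup S by split => //; exists z0.
(* [a] is the last charged point before [w]; some [f j] moves it to a charged
   point beyond [w]. *)
pose a := sup S.
have aw : a <= w by apply: ge_sup; [exists z0|move=> z [/andP[]]].
have a0 : 0 < a.
  by apply: (lt_le_trans _ (ub_le_sup ubS Sz0)); case: Sz0 => /andP[].
have a01 : 0 < a < 1 by rewrite a0 (le_lt_trans aw).
have ca : charged mu a.
  apply: charged_closed => e e0.
  have [z Sz az] := sup_adherent e0 hsS.
  exists z; last by case: Sz.
  have := ub_le_sup ubS Sz; rewrite -/a => za.
  by rewrite ger0_norm ?subr_ge0// ltrBlDr addrC -ltrBlDr.
have [i [j /andP[ia aj]]] := moves a01.
have /andP[fi0 fi1] := Hplus_itvoo (f i) a01.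
have /andP[fj0 fj1] := Hplus_itvoo (f j) a01.
have [wj|jw] := ltP w (f j a).
  (* Midpoints keep strict room both around [w] and inside the interval from [f i a] to [f j a]. *)
  exists ((f i a + a) / 2), ((w + f j a) / 2); split.
  - by apply/andP; split; lra.
  - by apply/andP; split; lra.
  - apply: (charged_gap_cvg0 sum_p invmu a01 ca (i := i) (j := j)).
    + by rewrite I01E; apply/andP; split; lra.
    + by rewrite I01E; apply/andP; split; lra.
    + lra.
    + lra.
    + lra.
exfalso.
(* Here [f j a <= w] would be a charged point of [S] above its supremum [a]. *)
have : S (f j a) by split; [rewrite fj0|exact: charged_image].
by move=> /(ub_le_sup ubS); rewrite -/a leNgt aj.
Qed.

(** Local to global: let [s] be the supremum of the points of [[x, y]] up to which the increment
    vanishes. Flatness around [s] would extend this set past [s] unless [y] is already reached. *)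
Lemma iter_dual_op_id_flat x y : 0 < x -> x <= y -> y < 1 ->
  g n y - g n x @[n --> \oo] --> 0.
Proof.
move=> x0 xy y1.
have I t : x <= t <= y -> I01 t.
  by rewrite I01E => /andP[? ?]; apply/andP; split; lra.
pose S := [set t : R | x <= t <= y /\ (g n t - g n x @[n --> \oo] --> (0 : R))].
have Sx : S x.
  split; first by rewrite lexx.
  by under eq_fun do rewrite subrr; exact: cvg_cst.
have ubS : has_ubound S by exists y => z [/andP[]].
have hsS : has_sup S by split => //; exists x.
pose s := sup S.
have sy : s <= y by apply: ge_sup; [exists x|move=> z [/andP[]]].
have xs : x <= s by exact: (ub_le_sup ubS Sx).
have s01 : 0 < s < 1 by apply/andP; split; lra.
have [u [v [/andP[u0 us] /andP[sv v1] uv]]] := locally_flat s01.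
have su0 : 0 < s - u by rewrite subr_gt0.
have [t St ut] := sup_adherent su0 hsS.
have ts := ub_le_sup ubS St.
move: ut; rewrite -/s opprB addrC subrK => ut.
have [/andP[xt ty] cxt] := St.
(* The furthest point of [[x, y]] reachable from [t] inside the flat interval [[u, v]]. *)
pose m := Num.min v y.
have tm : t <= m by rewrite le_min ty (le_trans ts (ltW sv)).
have Sm : S m.
  split; first by rewrite (le_trans xt tm) ge_min lexx orbT.
  have ctm : g n m - g n t @[n --> \oo] --> (0 : R).
    apply: (squeeze_cvgr _ (cvg_cst 0) uv).
    have It : I01 t by apply: I; rewrite xt.
    have Im : I01 m by apply: I; rewrite (le_trans xt tm) ge_min lexx orbT.
    have Iu : I01 u by rewrite I01E; apply/andP; split; lra.
    have Iv : I01 v by rewrite I01E; apply/andP; split; lra.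
    apply: nearW => n; rewrite subr_ge0 iter_dual_op_id_le//=.
    by apply: lerB; apply: iter_dual_op_id_le => //; [rewrite ge_min lexx|exact: ltW].
  rewrite -(addr0 (0 : R)); apply: cvg_trans (cvgD ctm cxt).
  by apply: near_eq_cvg; apply: nearW => n /=; rewrite addrA subrK.
have ms : m <= s := ub_le_sup ubS Sm.
suff -> : y = m by case: Sm.
apply/esym/min_idPr; move: ms; rewrite ge_min => /orP[vs|ys].
  by move: sv; rewrite ltNge vs.
by rewrite (le_trans ys (ltW sv)).
Qed.

End support.

(** * Asymptotic constancy of $U^n\varphi$ and convergence of its integrals *)

Section stability.
Context {R : realType} {N : nat}.
Variables (f : 'I_N -> Hplus R) (p : 'I_N -> {posnum R}).
Hypothesis Hadm : admissible f p.
Variable mu_star : probability (measurableTypeR R) R.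
Hypothesis Hstar : M1_01 mu_star.
Hypothesis Hinv : invariant_measure f p mu_star.
Variable phi : R -> R.
Hypothesis cphi : {within I01, continuous phi}.
Implicit Types (x y : R) (n : nat).

Local Notation U := (dual_op f p).
Local Notation g n := (iter n U idfun).

Let sum_p := admissible_sum Hadm.

Lemma iter_dual_op_merge x y : 0 < x -> x <= y -> y < 1 ->
  iter n U phi x - iter n U phi y @[n --> \oo] --> 0.
Proof.
move=> x0 xy y1; apply/cvgrPdist_lt => e e0.
have e20 : 0 < e / 2 by rewrite divr_gt0.
have [C C0 hC] := cont01_lipschitz_up_to cphi e20.
(* The constant [C] may be 0, so the tolerance is divided by [C + 1] instead. *)
have C10 : 0 < C + 1 by rewrite ltr_wpDl.
have Ix : I01 x by rewrite I01E; apply/andP; split; lra.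
have Iy : I01 y by rewrite I01E; apply/andP; split; lra.
have := iter_dual_op_id_flat sum_p (admissible_move Hadm) Hinv Hstar x0 xy y1.
move=> /cvgrPdist_lt/(_ (e / 2 / (C + 1)) (divr_gt0 e20 C10)).
apply: filterS => n; rewrite !sub0r !normrN => H.
rewrite (le_lt_trans (iter_dual_op_lipschitz_up_to f sum_p n hC Ix Iy xy))//.
rewrite [ltRHS]splitr ltrD2l; move: H; rewrite ltr_pdivlMr//; apply: le_lt_trans.
rewrite mulrC ler_pM//; last by rewrite lerDl.
  by rewrite subr_ge0 iter_dual_op_id_le.
exact: ler_norm.
Qed.

(** Averaging does not increase a uniform bound; this supplies the dominating constant below. *)
Lemma iter_dual_op_bounded h M : (forall x, I01 x -> `|h x| <= M) ->
  forall n x, I01 x -> `|iter n U h x| <= M.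
Proof.
move=> hM; elim=> //= n ih x Ix.
rewrite -(mul1r M) -sum_p mulr_suml (le_trans (ler_norm_sum _ _ _))//.
apply: ler_sum => i _; rewrite normrM gtr0_norm// ler_wpM2l// ih//.
exact: Hplus_I01.
Qed.

Lemma M1_01_I01 (nu : probability (measurableTypeR R) R) :
  M1_01 nu -> nu I01 = 1%E.
Proof.
move=> [nuC _]; have := @probability_setC _ _ _ nu _ (@measurable_I01 R).
rewrite nuC => /esym/eqP; rewrite sube_eq ?fin_num_measure//=.
by rewrite add0e => /eqP.
Qed.

(** The value at the interior point 1/2 serves as the asymptotic constant. It integrates to itself
    because [nu] has mass 1 on $[0,1]$, and dominated convergence applies to the difference. *)
Lemma Rintegral_iter_dual_op_cvg (nu : probability (measurableTypeR R) R) :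
  M1_01 nu ->
  \int[nu]_(x in I01) iter n U phi x - iter n U phi 2^-1 @[n --> \oo] --> 0.
Proof.
move=> nu01.
have mI := @measurable_I01 R.
have I2 : I01 (2^-1 : R) by rewrite I01E; apply/andP; split; lra.
have cU n : {within I01, continuous (iter n U phi)} by exact: cont01_iter_dual_op.
have [M M0 hM] := cont01_bounded cphi.
pose h n x := iter n U phi x - iter n U phi 2^-1.
have ch n : {within I01, continuous (h n)}.
  by apply: cont01B => //; exact: cont01_cst.
have intE n : \int[nu]_(x in I01) iter n U phi x - iter n U phi 2^-1 =
    \int[nu]_(x in I01) h n x.
  rewrite RintegralB//; [|exact: cont01_integrable|].
    by rewrite Rintegral_cst// [X in fine X](M1_01_I01 nu01) mulr1.
  by apply: cont01_integrable; exact: cont01_cst.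
under eq_fun do rewrite intE.
have merge x : 0 < x < 1 -> h n x @[n --> \oo] --> (0 : R).
  move=> /andP[x0 x1].
  (* [iter_dual_op_merge] takes its points in increasing order, so beyond 1/2 the difference changes
     sign. *)
  have [x2|x2] := leP x 2^-1; first by apply: iter_dual_op_merge => //; lra.
  rewrite -[0 : R]oppr0; under eq_fun do rewrite /h -opprB.
  by apply: cvgN; apply: iter_dual_op_merge => //; lra.
have [] := @dominated_convergence _ _ _ nu I01 mI (fun n x => (h n x)%:E)
  (cst 0%E) (cst (M + M)%:E).
- by move=> n; apply/measurable_EFinP; exact: cont01_measurable.
- exact: measurable_cst.
(* Pointwise convergence is known on $(0,1)$, and the two endpoints are null for [nu]. *)
- exists [set 0; 1]; split; [exact: measurableU|exact: nu01.2|].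
  move=> x /= /not_implyP[]; rewrite I01E !le_eqVlt.
  move=> /andP[/predU1P[<-|x0] /predU1P[->|x1]]; try by [left|right].
  by case; apply: cvg_EFin; [exact: nearW|apply: merge; rewrite x0].
- by apply: cont01_integrable; exact: cont01_cst.
- apply/aeW => x n Ix; rewrite /= lee_fin (le_trans (ler_normB _ _))// lerD//;
    exact: iter_dual_op_bounded.
move=> _ _; rewrite integral_cst// mul0e => H.
exact: (fine_cvg H).
Qed.

Lemma invariant_Rintegral_iter_dual_op n :
  \int[mu_star]_(x in I01) iter n U phi x = \int[mu_star]_(x in I01) phi x.
Proof.
elim: n => // n ih; rewrite iterS (invariant_Rintegral_dual_op Hinv)//.
exact: cont01_iter_dual_op.
Qed.

End stability.

Theorem theorem2 (R : realType) (N : nat)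
    (f : 'I_N -> Hplus R) (p : 'I_N -> {posnum R})
    (Hadm : admissible f p)
    (mu_star : probability (measurableTypeR R) R)
    (Hstar : M1_01 mu_star)
    (Hinv : invariant_measure f p mu_star)
    (mu : probability (measurableTypeR R) R)
    (Hmu : M1_01 mu)
    (phi : R -> R)
    (Hphi : {within I01, continuous phi}) :
  \int[iter n (markov_op f p) mu]_(x in I01) phi x @[n --> \oo]
    --> \int[mu_star]_(x in I01) phi x.
Proof.
under eq_fun do rewrite Rintegral_iter_markov_op//.
pose c n := iter n (dual_op f p) phi 2^-1.
pose I (nu : probability (measurableTypeR R) R) n :=
  \int[nu]_(x in I01) iter n (dual_op f p) phi x.
(* Both integrals approach the same sequence [c], whose own convergence need not be known
   beforehand; the one against [mu_star] is constant in [n] by invariance. *)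
have H : (I mu n - c n) - (I mu_star n - c n) + \int[mu_star]_(x in I01) phi x
    @[n --> \oo] --> 0 - 0 + \int[mu_star]_(x in I01) phi x.
  apply: cvgD; last exact: cvg_cst.
  apply: cvgB; first exact: (Rintegral_iter_dual_op_cvg Hadm Hstar Hinv Hphi Hmu).
  exact: (Rintegral_iter_dual_op_cvg Hadm Hstar Hinv Hphi Hstar).
rewrite subrr add0r in H; apply: cvg_trans H.
apply: near_eq_cvg; apply: nearW => n; rewrite /I/=.
by rewrite (invariant_Rintegral_iter_dual_op Hinv Hphi)// opprB addrA subrK subrK.
Qed.
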